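(* Let $A\in\mathbb{R}^{p\times p}$, $B_i\in\mathbb{R}^{p\times q_i}$ and $C_i\in\mathbb{R}^{m_i\times p}$ for $i=1,\dots,\kappa$, let $B=[B_1\ \cdots\ B_\kappa]\in\mathbb{R}^{p\times q}$ with $q=\sum_{i=1}^\kappa q_i$. Suppose $C_j\ne 0$ for all $j$, that $\bigcap_{i=1}^\kappa\mathrm{range}(B_i)\neq\{0\}$, and that $(A,B)$ is controllable. Then the following procedure can be carried out: (1) choose any $v\in\mathbb{R}^q$ such that $Bv\neq 0$ and $Bv\in\bigcap_{i=1}^\kappa\mathrm{range}(B_i)$; (2) compute $K'\in\mathbb{R}^{q\times p}$ such that $(A+BK',Bv)$ is controllable; (3) compute $G\in\mathbb{R}^{1\times p}$ such that $A+BK'+BvG$ is Schur stable; (4) set $K=K'+vG$. Moreover, any $K$ it produces is such that $A+BK$ is Schur stable and, for all $i,j\in\{1,\dots,\kappa\}$, the integer $k'_{i,j}=\min\{k\ge 0: C_j(A+BK)^kB_i\neq 0\}$ exists and satisfies $k'_{i,j}\le p-1$.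
   Context: A real square matrix is Schur stable if all its eigenvalues have modulus strictly less than $1$. A pair $(M,N)$ with $M\in\mathbb{R}^{p\times p}$ and $N\in\mathbb{R}^{p\times r}$ is controllable if $[N\ \ MN\ \cdots\ M^{p-1}N]$ has rank $p$. Here $\mathrm{range}(M)$ denotes the column space of $M$. *)

(* Defs.v *)
From HB Require Import structures.
From mathcomp Require Import all_boot all_order all_algebra.
From mathcomp Require Import complex.
From mathcomp Require Import boolp classical_sets reals.

Set Implicit Arguments.
Unset Strict Implicit.
Unset Printing Implicit Defensive.

Import Order.TTheory GRing.Theory Num.Theory.
Local Open Scope ring_scope.

(* The eigenvalues are the complex ones. Library eigenvectors are row vectors;
   the left and right eigenvalues of a square matrix coincide. The norm on R[i]
   is R[i]-valued, and [`|z| < 1] holds there iff the real modulus is < 1. *)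
Definition schur_stable (R : realType) (p : nat) (M : 'M[R]_p) : Prop :=
  forall z : R[i], eigenvalue (map_mx (real_complex R) M) z -> `|z| < 1.

Definition ctrb_mx (R : realType) (p r : nat) (M : 'M[R]_p) (N : 'M[R]_(p, r))
    : 'M[R]_(p, \sum_(k < p) r) :=
  \mxrow_(k < p) (M ^+ k *m N).

Definition controllable (R : realType) (p r : nat)
    (M : 'M[R]_p) (N : 'M[R]_(p, r)) : Prop :=
  \rank (ctrb_mx M N) = p.

(* MathComp's subspace notions are about row spaces; this is the column space. *)
Definition mxrange (R : realType) (p r : nat) (M : 'M[R]_(p, r)) :
    set 'cV[R]_p :=
  range (fun u : 'cV[R]_r => M *m u).

Definition is_min_nat (P : nat -> Prop) (k : nat) : Prop :=
  P k /\ forall l : nat, P l -> (k <= l)%N.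

(* Main.v *)
Require Import Defs.
From HB Require Import structures.
From mathcomp Require Import all_boot all_order all_algebra.
From mathcomp Require Import complex.
From mathcomp Require Import boolp classical_sets reals.

Set Implicit Arguments.
Unset Strict Implicit.
Unset Printing Implicit Defensive.

Import Order.TTheory GRing.Theory Num.Theory.
Local Open Scope ring_scope.

(** Controllability of [(M, N)] means that no nonzero row vector [c] has
    [c M^k N = 0] for all [k < p] ([controllableP]). In this form it is
    unaffected by state feedback [M + N F]: if [c M^k N] vanishes for small
    [k], then [c (M + N F)^k = c M^k] for those [k]
    ([row_power_feedback], [controllable_feedback]).

    Step (1) is possible because a nonzero vector of the intersection lies in
    the range of one [B_i], hence in that of [B]; there is at least one index
    [i], since otherwise [B] is empty and controllability forces [p = 0].

    Step (2) is Heymann's lemma ([heymann_feedback]), applied to [(M, N) = (A, B)]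
    and [b = B v]. The feedback is improved until [b], [M b], ...,
    [M^(p-1) b] are independent, one vector at a time. If the
    first [n + 1 < p] iterates are independent but span an [M]-invariant
    subspace, this subspace is proper, so by controllability it
    misses some column [N e_j]. Adding the feedback [e_j f], where [f] is zero
    on the first [n] iterates and one on the last, keeps these [n + 1] iterates
    and pushes the next one out of their span ([krylov_extend]).

    For step (3) it is enough to place all eigenvalues at zero
    ([deadbeat_feedback]). With [g] the row vector such that [g M^k b] is [0]
    for [k < p - 1] and [1] for [k = p - 1], Ackermann's choice
    [G = - g M^p] gives [g (M + b G)^p = 0]. Then [(M + b G)^p] is killed by
    every [g (M + b G)^k = g M^k], [k < p], and these rows form a basis.

    Finally, [A + B K] with [K = K' + v G] is [A + B K' + (B v) G], and
    [(A + B K, B v)] is controllable as a feedback transform of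
    [(A + B K', B v)]. Since [B v = B_i u] for some [u], vanishing of
    [C_j (A + B K)^k B_i] for all [k < p] would give
    [C_j (A + B K)^k B v = 0] for these [k], hence [C_j = 0]
    ([controllable_min_markov]). *)

(** * Controllability and state feedback *)

(** The dual of the rank condition: it replaces the block matrix by equations
    on a test matrix [c], on which feedback acts simply. *)
Lemma controllableP (R : realType) (p r : nat) (M : 'M[R]_p) (N : 'M[R]_(p, r)) :
  controllable M N <->
  forall n (c : 'M[R]_(n, p)),
    (forall k, (k < p)%N -> c *m M ^+ k *m N = 0) -> c = 0.
Proof.
have ctrb0 n (c : 'M[R]_(n, p)) : c *m ctrb_mx M N = 0 <->
    forall k, (k < p)%N -> c *m M ^+ k *m N = 0.
  rewrite /ctrb_mx mul_mxrow -(mxrow0 (q_ := fun=> r)) -eq_mxrowP.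
  split=> [h k ltkp|h k]; first by rewrite -mulmxA (h (Ordinal ltkp)).
  by rewrite mulmxA h.
rewrite /controllable; split=> [ctrb_full n c /ctrb0 c0|ker0].
  have freeC : row_free (ctrb_mx M N) by apply/eqP.
  by apply/eqP; rewrite -(mulmx_free_eq0 c freeC) c0.
by apply/eqP; rewrite -/(row_free _) -kermx_eq0; apply/eqP/ker0/ctrb0/mulmx_ker.
Qed.

(** A test matrix that annihilates the input at each of the first [n] steps does
    not see the feedback at these steps. *)
Lemma row_power_feedback (R : realType) (p r s n : nat) (M : 'M[R]_p)
    (N : 'M[R]_(p, r)) (F : 'M[R]_(r, p)) (c : 'M[R]_(s, p)) :
  (forall k, (k < n)%N -> c *m M ^+ k *m N = 0) ->
  forall k, (k <= n)%N -> c *m (M + N *m F) ^+ k = c *m M ^+ k.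
Proof.
move=> cN0; elim=> [|k IHk] ltkn; first by rewrite !expr0.
rewrite !exprSr -!mulmxE !mulmxA IHk ?(ltnW ltkn) // mulmxDr.
by rewrite [c *m M ^+ k *m (N *m F)]mulmxA cN0 // mul0mx addr0.
Qed.

(** Dually, a feedback that reads zero along the first [n] iterates of [b] does
    not change them. *)
Lemma power_feedback_col (R : realType) (p r s n : nat) (M : 'M[R]_p)
    (N : 'M[R]_(p, r)) (F : 'M[R]_(r, p)) (b : 'M[R]_(p, s)) :
  (forall k, (k < n)%N -> F *m (M ^+ k *m b) = 0) ->
  forall k, (k <= n)%N -> (M + N *m F) ^+ k *m b = M ^+ k *m b.
Proof.
move=> Fb0; elim=> [|k IHk] ltkn; first by rewrite !expr0.
rewrite !exprS -!mulmxE -!mulmxA IHk ?(ltnW ltkn) // mulmxDl.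
by rewrite -(mulmxA N) Fb0 // mulmx0 addr0.
Qed.

(** A test matrix for the closed loop is one for the open loop, because [M] is
    recovered from [M + N F] by the feedback [- F]. *)
Lemma controllable_feedback (R : realType) (p r : nat) (M : 'M[R]_p)
    (N : 'M[R]_(p, r)) (F : 'M[R]_(r, p)) :
  controllable M N -> controllable (M + N *m F) N.
Proof.
move=> /controllableP ctrlMN; apply/controllableP => n c c0.
apply: ctrlMN => k ltkp; rewrite -(c0 k ltkp).
have -> : M = M + N *m F + N *m (- F) by rewrite mulmxN addrK.
rewrite (row_power_feedback _ c0) ?(ltnW ltkp) //.
by rewrite mulmxN addrK.
Qed.

(** * Krylov matrices *)

(** The iterates are stored as rows, so that the row-space calculus applies to
    their span. *)
Definition krylov (R : realType) (p : nat) (M : 'M[R]_p) (b : 'cV[R]_p) (n : nat)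
    : 'M[R]_(n, p) :=
  \matrix_(i < n) (M ^+ i *m b)^T.

Lemma krylov_sub (R : realType) (p m n : nat) (M : 'M[R]_p) (b : 'cV[R]_p)
    (L : 'M[R]_(m, p)) :
  (krylov M b n <= L)%MS <-> forall i, (i < n)%N -> ((M ^+ i *m b)^T <= L)%MS.
Proof.
split=> [/row_subP h i ltin|h]; first by have := h (Ordinal ltin); rewrite rowK.
by apply/row_subP => i; rewrite rowK h.
Qed.

Lemma row_free_krylovS (R : realType) (p n : nat) (M : 'M[R]_p) (b : 'cV[R]_p) :
  row_free (krylov M b n) -> ~~ ((M ^+ n *m b)^T <= krylov M b n)%MS ->
  row_free (krylov M b n.+1).
Proof.
move=> /eqP rk notin.
have all_in i : (i < n.+1)%N -> ((M ^+ i *m b)^T <= krylov M b n.+1)%MS.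
  by move: i; apply/krylov_sub.
have : (krylov M b n < krylov M b n.+1)%MS.
  apply/andP; split; first by apply/krylov_sub => i /ltnW/all_in.
  by apply: contra notin; apply: submx_trans; apply: all_in.
by rewrite ltmxErank rk /row_free eqn_leq rank_leq_row => /andP[].
Qed.

(** The cokernel of [L], transposed, is a test matrix for controllability. *)
Lemma controllable_row_full (R : realType) (p r n : nat) (M : 'M[R]_p)
    (N : 'M[R]_(p, r)) (L : 'M[R]_(n, p)) :
  controllable M N ->
  (forall k, (k < p)%N -> ((M ^+ k *m N)^T <= L)%MS) -> row_full L.
Proof.
move=> /controllableP ctrl inL; rewrite -cokermx_eq0 -trmx_eq0.
apply/eqP/ctrl => k /inL; rewrite submxE => /eqP inL0.
by apply: trmx_inj; rewrite -mulmxA trmx_mul trmxK inL0 trmx0.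
Qed.

Lemma controllable_krylov (R : realType) (p : nat) (M : 'M[R]_p) (b : 'cV[R]_p) :
  controllable M b <-> row_free (krylov M b p).
Proof.
split=> [ctrl|freeX].
  rewrite row_free_unit -row_full_unit; apply: (controllable_row_full ctrl).
  exact/krylov_sub.
apply/controllableP => n c c0; apply: trmx_inj; rewrite trmx0.
have Xu : krylov M b p \in unitmx by rewrite -row_free_unit.
rewrite -[c^T](mulKmx Xu); apply/eqP; rewrite (_ : _ *m c^T = 0) ?mulmx0 //.
apply/row_matrixP => i; rewrite row_mul rowK row0 -trmx_mul mulmxA c0 //.
by rewrite trmx0.
Qed.

(** The last column of a right inverse of the Krylov matrix is the coordinate
    functional of the last iterate. It provides both the correction in
    [krylov_extend] and the row [g] of Ackermann's formula. *)
Lemma krylov_last_coordinate (R : realType) (p n : nat) (M : 'M[R]_p)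
    (b : 'cV[R]_p) :
  row_free (krylov M b n.+1) ->
  exists f : 'rV[R]_p, forall i, (i < n.+1)%N ->
    f *m (M ^+ i *m b) = (i == n)%:R%:M.
Proof.
move=> freeX; exists (col ord_max (pinvmx (krylov M b n.+1)))^T => i ltin.
apply: trmx_inj; rewrite trmx_mul trmxK tr_scalar_mx.
have -> : (M ^+ i *m b)^T = row (Ordinal ltin) (krylov M b n.+1) by rewrite rowK.
rewrite -row_mul colE mulmxA mulmxVp // mul1mx; apply/matrixP=> x y.
by rewrite !mxE !ord1 eqxx !andbT mulr1n.
Qed.

(** * Heymann's lemma *)

(** If the next iterate leaves the span of the first [n.+1], no feedback is
    needed. Otherwise the span is invariant, and a rank-one feedback acting
    only on the last iterate adds to the next one a column of [N] outside the
    span. *)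
Lemma krylov_extend (R : realType) (p r n : nat) (M : 'M[R]_p)
    (N : 'M[R]_(p, r)) (b : 'cV[R]_p) :
  controllable M N -> (n.+1 < p)%N -> row_free (krylov M b n.+1) ->
  exists F : 'M[R]_(r, p), row_free (krylov (M + N *m F) b n.+2).
Proof.
move=> ctrl ltnp freeX; set X := krylov M b n.+1 in freeX *.
have [in_X|notin_X] := boolP ((M ^+ n.+1 *m b)^T <= X)%MS; last first.
  by exists 0; rewrite mulmx0 addr0 row_free_krylovS.
have b_in_X i : (i < n.+1)%N -> ((M ^+ i *m b)^T <= X)%MS.
  by move: i; apply/krylov_sub.
have stableX : (X *m M^T <= X)%MS.
  apply/row_subP => i; rewrite row_mul rowK -trmx_mul mulmxA mulmxE -exprS.
  have := ltn_ord i; rewrite ltnS leq_eqVlt => /orP[/eqP ->//|ltin].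
  exact: b_in_X.
(* An invariant span that contains range N is the whole space by
   controllability, but this one has dimension n.+1 < p. *)
have /row_subPn[j notin_N] : ~~ (N^T <= X)%MS.
  apply/negP => NX; suff /eqP : row_full X.
    by move=> eqp; have := rank_leq_row X; rewrite eqp leqNgt ltnp.
  apply: (controllable_row_full ctrl) => k _.
  elim: k => [|k IHk]; first by rewrite expr0 mul1mx.
  rewrite exprS -mulmxE -mulmxA trmx_mul.
  exact: submx_trans (submxMr _ IHk) stableX.
have [f fP] := krylov_last_coordinate freeX.
exists (delta_mx j 0 *m f); rewrite mulmxA -colE; set M' := M + _.
have eqM' i : (i <= n)%N -> M' ^+ i *m b = M ^+ i *m b.
  move: i; apply: power_feedback_col => k ltkn.
  by rewrite fP ?(leqW ltkn) // ltn_eqF // raddf0.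
have eqX : krylov M' b n.+1 = X.
  by apply/row_matrixP => i; rewrite !rowK eqM' // -ltnS.
apply: row_free_krylovS; rewrite eqX //.
rewrite exprS -mulmxE -mulmxA eqM' // mulmxDl -(mulmxA (col j N)) fP // eqxx.
rewrite mulmx1 mulmxA mulmxE -exprS linearD /= tr_col.
apply: contra notin_N => sum_in_X.
by rewrite -(addKr (M ^+ n.+1 *m b)^T (row j N^T)) addmx_sub // eqmx_opp.
Qed.

(** The feedbacks found by [krylov_extend] add up, since each of them leaves the
    pair with input matrix [N] controllable. *)
Lemma heymann_feedback (R : realType) (p r : nat) (M : 'M[R]_p) (N : 'M[R]_(p, r))
    (b : 'cV[R]_p) :
  controllable M N -> b != 0 ->
  exists F : 'M[R]_(r, p), controllable (M + N *m F) b.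
Proof.
move=> ctrl b_neq0.
case: p => [|p'] in M N b ctrl b_neq0 *.
  by rewrite flatmx0 eqxx in b_neq0.
suff /(_ p' (leqnn _))[F freeX] : forall n, (n <= p')%N ->
    exists F : 'M[R]_(r, p'.+1), row_free (krylov (M + N *m F) b n.+1).
  by exists F; apply/controllable_krylov.
elim=> [_|n IHn lenp].
  exists 0; rewrite -kermx_eq0; apply/eqP/row_matrixP => i.
  rewrite row0; set c := row i _.
  have : c *m krylov (M + N *m 0) b 1 = 0 by rewrite -row_mul mulmx_ker row0.
  have -> : krylov (M + N *m 0) b 1 = b^T.
    by apply/row_matrixP => k; rewrite rowK ord1 expr0 mul1mx row_id.
  rewrite [c]mx11_scalar mul_scalar_mx => /eqP.
  by rewrite scaler_eq0 trmx_eq0 (negPf b_neq0) orbF => /eqP ->; rewrite raddf0.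
have [F freeX] := IHn (ltnW lenp).
have [F' freeX'] := krylov_extend (controllable_feedback F ctrl) lenp freeX.
by exists (F + F'); rewrite mulmxDr addrA.
Qed.

(** * Deadbeat control and Schur stability *)

(** Nilpotency replaces a computation of the characteristic polynomial: it is
    checked on the basis of rows [g *m M ^+ k]. *)
Lemma deadbeat_feedback (R : realType) (p : nat) (M : 'M[R]_p) (b : 'cV[R]_p) :
  controllable M b -> exists G : 'rV[R]_p, (M + b *m G) ^+ p = 0.
Proof.
case: p => [|n] in M b * => /controllable_krylov freeX.
  by exists 0; apply: flatmx0.
have [g gP] := krylov_last_coordinate freeX.
have g0 k : (k < n)%N -> g *m M ^+ k *m b = 0.
  by move=> ltkn; rewrite -mulmxA gP ?(leqW ltkn) // ltn_eqF // raddf0.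
pose G := - (g *m M ^+ n.+1); exists G; set M' := M + b *m G.
have gM' k : (k <= n)%N -> g *m M' ^+ k = g *m M ^+ k.
  exact: row_power_feedback.
have gM'0 : g *m M' ^+ n.+1 = 0.
  rewrite exprSr -mulmxE mulmxA gM' // mulmxDr.
  rewrite [X in _ + X]mulmxA -[X in _ + X *m _]mulmxA gP // eqxx.
  by rewrite mul1mx -mulmxA mulmxE -exprSr subrr.
(* In decreasing order of the powers, the pairing of the rows g M^k with the
   iterates of b is lower triangular with ones on the diagonal. *)
pose W : 'M[R]_n.+1 := \matrix_(j < n.+1) (g *m M ^+ (n - j)).
have XW i j : (krylov M b n.+1 *m W^T) i j = (g *m (M ^+ (n - j + i) *m b)) 0 0.
  transitivity ((row i (krylov M b n.+1) *m (row j W)^T) 0 0).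
    by rewrite !mxE; apply: eq_bigr => k _; rewrite !mxE.
  rewrite !rowK -trmx_mul mxE exprD -mulmxE.
  by rewrite !mulmxA.
have Wu : W \in unitmx.
  have : krylov M b n.+1 *m W^T \in unitmx.
    rewrite unitmxE det_trig ?big1 ?unitr1 // => [i _|].
      by rewrite XW subnK ?gP ?eqxx ?mxE // -ltnS.
    apply/is_trig_mxP => i j ltij; rewrite XW mulmxA g0 ?mxE //.
    have := ltn_ord j; rewrite ltnS => lejn.
    by rewrite -[ltnRHS](subnK lejn) ltn_add2l.
  by rewrite unitmx_mul unitmx_tr => /andP[].
rewrite -[LHS](mulKmx Wu) (_ : W *m _ = 0) ?mulmx0 //.
apply/row_matrixP => j; rewrite row_mul rowK row0 -gM' ?leq_subr //.
by rewrite -mulmxA mulmxE -exprD addnC exprD -mulmxE mulmxA gM'0 mul0mx.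
Qed.

Lemma nilpotent_schur_stable (R : realType) (p n : nat) (M : 'M[R]_p) :
  M ^+ n = 0 -> schur_stable M.
Proof.
move=> Mn0 z /eigenvalueP[v vz v_neq0].
have vzn k : v *m map_mx (real_complex R) (M ^+ k) = z ^+ k *: v.
  elim: k => [|k IHk]; first by rewrite !expr0 map_mx1 mulmx1 scale1r.
  rewrite exprS -mulmxE map_mxM mulmxA vz -scalemxAl IHk scalerA.
  by rewrite exprS.
have := vzn n; rewrite Mn0 map_mx0 mulmx0 => /esym/eqP.
rewrite scaler_eq0 (negPf v_neq0) orbF expf_eq0 => /andP[_ /eqP->].
by rewrite normr0 ltr01.
Qed.

(** The output matrix [C] itself is used as a test matrix: if all
    [C M^k N], [k < p], vanished, so would all [C M^k (N u)], hence [C]. *)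
Lemma controllable_min_markov (R : realType) (p r m : nat) (M : 'M[R]_p)
    (N : 'M[R]_(p, r)) (C : 'M[R]_(m, p)) (u : 'cV[R]_r) :
  controllable M (N *m u) -> C <> 0 ->
  exists k, is_min_nat (fun k => C *m M ^+ k *m N <> 0) k /\ (k <= p - 1)%N.
Proof.
move=> /controllableP ctrl C_neq0; pose P k := C *m M ^+ k *m N != 0.
have [k ltkp Pk] : exists2 k, (k < p)%N & P k.
  apply: contrapT => noP; apply/C_neq0/ctrl => k ltkp.
  rewrite mulmxA; have [->|Pk] := eqVneq (C *m M ^+ k *m N) 0.
    by rewrite mul0mx.
  by case: noP; exists k.
have [l Pl minl] := ex_minnP (ex_intro P k Pk).
exists l; split; first by split=> [|h /eqP/minl//]; apply/eqP.
by rewrite (leq_trans (minl k Pk)) // subn1 -ltnS prednK // (leq_trans _ ltkp).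
Qed.

(** * The design procedure *)

Theorem proposition3 (R : realType) (p kappa : nat) (q m : 'I_kappa -> nat)
    (A : 'M[R]_p)
    (Bs : forall i : 'I_kappa, 'M[R]_(p, q i))
    (Cs : forall i : 'I_kappa, 'M[R]_(m i, p)) :
  let B : 'M[R]_(p, \sum_(i < kappa) q i) := \mxrow_(i < kappa) Bs i in
  let V : set 'cV[R]_p := (\bigcap_i mxrange (Bs i))%classic in
  (forall j : 'I_kappa, Cs j <> 0) ->
  V <> [set 0]%classic ->
  controllable A B ->
  let step1 (v : 'cV[R]_(\sum_(i < kappa) q i)) : Prop :=
    B *m v <> 0 /\ V (B *m v) in
  let step2 (v : 'cV[R]_(\sum_(i < kappa) q i))
            (K' : 'M[R]_(\sum_(i < kappa) q i, p)) : Prop :=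
    controllable (A + B *m K') (B *m v) in
  let step3 (v : 'cV[R]_(\sum_(i < kappa) q i))
            (K' : 'M[R]_(\sum_(i < kappa) q i, p)) (G : 'rV[R]_p) : Prop :=
    schur_stable (A + B *m K' + B *m v *m G) in
  [/\ exists v, step1 v,
      forall v, step1 v -> exists K', step2 v K',
      forall v K', step1 v -> step2 v K' -> exists G, step3 v K' G
    & forall v K' G (K : 'M[R]_(\sum_(i < kappa) q i, p)),
        step1 v -> step2 v K' -> step3 v K' G ->
        K = K' + v *m G ->
        schur_stable (A + B *m K) /\
        forall i j : 'I_kappa, exists k'ij : nat,
          is_min_nat (fun k => Cs j *m (A + B *m K) ^+ k *m Bs i <> 0) k'ij /\
          (k'ij <= p - 1)%N].
Proof.
move=> B V C_neq0 V_neq0 ctrl step1 step2 step3; split.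
- have [w Vw w_neq0] : exists2 w, V w & w <> 0.
    apply: contrapT => noV; apply: V_neq0; apply/seteqP; split=> [w Vw|_ ->].
      by apply: contrapT => w_neq0; apply: noV; exists w.
    by move=> i _; exists 0 => //; rewrite mulmx0.
  (* Without subsystems the range condition is void and B is empty; then
     controllability leaves only the zero state space. *)
  have [[i0 _]|noi] := pselect (exists i : 'I_kappa, True); last first.
    case: w_neq0; rewrite -[w]mul1mx; suff -> : 1%:M = 0 :> 'M[R]_p.
      by rewrite mul0mx.
    move/controllableP: ctrl; apply=> k _; suff -> : B = 0 by rewrite mulmx0.
    by apply/mxrowP => i; case: noi; exists i.
  have [u _ Bsu] := Vw i0 Logic.I.
  (* The block column of the identity at i0 pads u with zeros. *)
  suff Bv : B *m (submxrow 1%:M i0 *m u) = w.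
    by exists (submxrow 1%:M i0 *m u); rewrite /step1 Bv.
  by rewrite mulmxA mul_submxrow mulmx1 mxrowK.
- move=> v [/eqP Bv_neq0 _]; have [F ctrlF] := heymann_feedback ctrl Bv_neq0.
  by exists F.
- move=> v K' _ /deadbeat_feedback[G G0].
  by exists G; apply: nilpotent_schur_stable G0.
- move=> v K' G K [Bv_neq0 VBv] ctrlK' stableG ->.
  have eqM : A + B *m (K' + v *m G) = A + B *m K' + B *m v *m G.
    by rewrite mulmxDr mulmxA addrA.
  rewrite eqM; split=> // i j.
  have [u _ Bsu] := VBv i Logic.I.
  apply: (controllable_min_markov (u := u)) => //.
  by rewrite Bsu; apply: controllable_feedback.
Qed.
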